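(* For every $\alpha>0$ and every $\Delta$ there is a constant $c=c(\alpha,\Delta)$ such that the following holds. Let $G$ be a graph on the vertex set $[n]=\{1,\dots,n\}$ with minimum degree at least $\alpha n$, let $T$ be an $n$-vertex tree with maximum degree at most $\Delta$, and let $R\in\mathbb{G}(n,c/n)$. Then asymptotically almost surely $T\subseteq G\cup R$, i.e. the graph $G\cup R$ contains a copy of $T$ with probability tending to $1$ as $n\to\infty$.
   Context: $\mathbb{G}(n,p)$ denotes the binomial random graph on vertex set $[n]$ in which each of the $\binom{n}{2}$ possible edges is present independently with probability $p$. $G\cup R$ is the graph on $[n]$ whose edge set is the union of the edge sets of $G$ and $R$. The graphs $G$ and trees $T$ may depend on $n$; ''asymptotically almost surely'' (a.a.s.) means with probability $1-o(1)$ as $n\to\infty$. *)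

(* Defs.v *)
From HB Require Import structures.
From mathcomp Require Import all_boot all_order all_algebra.
From mathcomp Require Import all_classical all_reals all_analysis.
Set Implicit Arguments.
Unset Strict Implicit.
Unset Printing Implicit Defensive.
Import Order.TTheory GRing.Theory Num.Theory.
Import numFieldNormedType.Exports.
Local Open Scope ring_scope.

Record sgraph (V : finType) := SGraph {
  edges :> {set {set V}};
  edges_card2 : [forall e in edges, #|e| == 2%N] }.

HB.instance Definition _ (V : finType) := [isSub for @edges V].
HB.instance Definition _ (V : finType) := [Finite of sgraph V by <:].

(* [set x; x] is a singleton, hence never an edge: adj is irreflexive. *)
Definition adj (V : finType) (G : sgraph V) : rel V :=
  fun x y => [set x; y]%SET \in edges G.

Definition deg (V : finType) (G : sgraph V) (x : V) : nat :=
  #|[set y | adj G x y]%SET|.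

Lemma sunion_subproof (V : finType) (G H : sgraph V) :
  [forall e in (edges G :|: edges H)%SET, #|e| == 2%N].
Proof.
apply/forall_inP => e; rewrite inE => /orP[] he.
  exact: (forall_inP (edges_card2 G)).
exact: (forall_inP (edges_card2 H)).
Qed.

Definition sunion (V : finType) (G H : sgraph V) : sgraph V :=
  SGraph (sunion_subproof G H).

Definition connected_graph (V : finType) (G : sgraph V) : Prop :=
  (0 < #|V|)%N /\ forall x y : V, connect (adj G) x y.

(* Sequences of size 2 are excluded: x, y with x ~ y is a ucycle of adj. *)
Definition acyclic_graph (V : finType) (G : sgraph V) : Prop :=
  forall s : seq V, (2 < size s)%N -> ~ ucycle (adj G) s.

Definition is_tree (V : finType) (G : sgraph V) : Prop :=
  connected_graph G /\ acyclic_graph G.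

Definition contains_copy (W V : finType) (T : sgraph W) (G : sgraph V) : bool :=
  [exists f : {ffun W -> V}, injectiveb f &&
    [forall x, forall y, adj T x y ==> adj G (f x) (f y)]].

(* The product law on the 2-subsets of [n]: a probability when 0 <= p <= 1.  *)
Definition gnp_mass (R : realType) (n : nat) (p : R) (H : sgraph 'I_n) : R :=
  \prod_(e : {set 'I_n} | #|e| == 2%N) (if e \in edges H then p else 1 - p).

Definition gnp_prob (R : realType) (n : nat) (p : R)
    (A : pred (sgraph 'I_n)) : R :=
  \sum_(H : sgraph 'I_n | A H) gnp_mass p H.

(* Main.v *)
(* Order T so that every vertex but the first has exactly one earlier neighbour.
   A.a.s. R has an edge between any two disjoint sets of m = n/M vertices, and
   a Friedman-Pippenger argument then embeds the first n - e vertices of T into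
   R. Since the law of R is invariant under relabelling, this embedding may be
   composed with a uniformly random permutation; for all vertices u, v there are
   then, with overwhelming probability, at least e vertices t in a fixed family
   with pairwise disjoint stars such that t is placed in N_G(v) and all its tree
   neighbours in N_G(u). The last e vertices of T are added one by one: to attach
   a leaf at an embedded vertex placed on v, an unused vertex u takes over the
   role of such a t, whose former place becomes the image of the leaf. *)
Require Import Defs.
From HB Require Import structures.
From mathcomp Require Import all_boot all_order all_algebra all_fingroup.
From mathcomp Require Import zify ring lra reals.
Set Implicit Arguments.
Unset Strict Implicit.
Unset Printing Implicit Defensive.
Import Order.TTheory GRing.Theory Num.Theory.

(** * Trees in joined graphs *)

Section JoinedGraphs.
Variables (V : finType) (e : rel V).
Implicit Types (A B U W X Y : {set V}) (dem : V -> nat) (d m : nat).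

Definition nbh X : {set V} := [set y | [exists x in X, e x y]].

Definition joined m := forall A B : {set V},
  #|A| = m -> #|B| = m -> [disjoint A & B] ->
  exists a b, [/\ a \in A, b \in B & e a b].

(** Hall's condition for handing out disjoint sets of [dem x] neighbours in [U], tested only up to
    size [m.*2]: this range covers the union of two sets smaller than [m]. *)
Definition demand_ok W U dem m := forall X, X \subset W -> #|X| <= m.*2 ->
  \sum_(x in X) dem x <= #|nbh X :&: U|.

Lemma in_nbh X x y : x \in X -> e x y -> y \in nbh X.
Proof. by move=> xX exy; rewrite inE; apply/existsP; exists x; rewrite xX. Qed.

Lemma nbhU X Y : nbh (X :|: Y) = nbh X :|: nbh Y.
Proof.
apply/setP=> y; rewrite !inE; apply/existsP/orP => [[x]|].
  rewrite inE => /andP[/orP[xX|xY] exy]; [left|right]; apply/existsP; exists x.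
    by rewrite xX.
  by rewrite xY.
by case=> /existsP[x /andP[xX exy]]; exists x; rewrite inE xX ?orbT.
Qed.

Lemma nbhS X Y : X \subset Y -> nbh X \subset nbh Y.
Proof. by move=> sXY; rewrite -(setUidPr sXY) nbhU subsetUl. Qed.

(** Otherwise an [m]-subset of [X] and an [m]-subset of that complement would be disjoint with no
    edge between them. *)
Lemma joined_nbh m X : joined m -> m <= #|X| -> #|~: (nbh X :|: X)| < m.
Proof.
move=> jm mX; rewrite ltnNge; apply/negP => mC.
have ex_sub (Z : {set V}) : m <= #|Z| -> exists2 A : {set V}, A \subset Z & #|A| = m.
  move=> mZ; exists [set x in take m (enum Z)].
    apply/subsetP=> x; rewrite inE => /mem_take; by rewrite mem_enum.
  rewrite cardsE (card_uniqP _) ?take_uniq ?enum_uniq //.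
  by rewrite size_takel // -cardE.
have [A sAX cA] := ex_sub _ mX; have [B sBC cB] := ex_sub _ mC.
have dAB : [disjoint A & B].
  rewrite -setI_eq0 -subset0; apply/subsetP=> x; rewrite inE => /andP[xA xB].
  have := subsetP sBC _ xB; rewrite !inE (subsetP sAX _ xA) orbT //.
have [a [b [aA bB eab]]] := jm A B cA cB dAB.
have := subsetP sBC _ bB; rewrite in_setC in_setU.
by rewrite (in_nbh (subsetP sAX _ aA) eab).
Qed.

(* [|nbh X :&: U| - \sum_(x in X) dem x] is submodular, so the sets where it
   vanishes are closed under union; if no neighbour of s worked, the union of
   the sets witnessing the failures would be tight and already contain all
   available neighbours of s in its neighbourhood. *)
Lemma demand_step W U dem m s :
  0 < m -> demand_ok W U dem m ->
  (forall X, X \subset W -> m <= #|X| <= m.*2 ->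
     \sum_(x in X) dem x < #|nbh X :&: U|) ->
  s \in W -> 0 < dem s ->
  exists y, [/\ y \in U, e s y &
    demand_ok W (U :\ y) (fun v => dem v - (v == s)) m].
Proof.
move=> m_gt0 okW big sW ds.
pose tight X := [/\ X \subset W, #|X| < m, s \notin X
  & \sum_(x in X) dem x = #|nbh X :&: U|].
case: (pickP (fun y => [&& y \in U, e s y & [forall X : {set V},
    (X \subset W) ==> (#|X| <= m.*2) ==>
    (\sum_(x in X) (dem x - (x == s)) <= #|nbh X :&: (U :\ y)|)]])).
  move=> y /and3P[yU esy /forallP ok]; exists y; split=> // X XW cX.
  by move: (ok X); rewrite XW cX.
move=> nope; exfalso.
(* Removing [y] costs a set at most one neighbour. A set that fails afterwards was therefore tight,
   sees [y], and does not contain [s], whose demand would have dropped as well. *)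
have tight_y y : y \in U -> e s y -> exists2 X, tight X & y \in nbh X.
  move=> yU esy; have := nope y; rewrite yU esy /= => /negbT.
  case/forallPn=> X; rewrite !negb_imply -ltnNge => /and3P[XW cX ltX].
  have okX := okW X XW cX.
  have card_U : #|nbh X :&: U| = (y \in nbh X) + #|nbh X :&: (U :\ y)|.
    by rewrite setIDA (cardsD1 y (nbh X :&: U)) inE yU andbT.
  have sX : s \notin X.
    apply/negP=> sX.
    have : \sum_(x in X) dem x = (\sum_(x in X) (dem x - (x == s))).+1.
      rewrite !(bigD1 s sX) /= eqxx.
      rewrite [in RHS](eq_bigr dem) => [|x /andP[_ /negPf ->]]; first by lia.
      by rewrite subn0.
    by move: card_U ds; case: (y \in _) => /=; lia.
  have eq_dem : \sum_(x in X) (dem x - (x == s)) = \sum_(x in X) dem x.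
    apply: eq_bigr => x xX; case: eqP => [xs|]; last by rewrite subn0.
    by rewrite xs (negPf sX) in xX.
  have ltX' : #|nbh X :&: (U :\ y)| < \sum_(x in X) dem x by lia.
  have yX : y \in nbh X by move: card_U; case: (y \in _) => //=; lia.
  exists X => //; split=> //; last by rewrite yX in card_U; lia.
  rewrite ltnNge; apply/negP=> mX.
  by have := big X XW; rewrite yX in card_U; rewrite mX cX => /(_ isT); lia.
have tightU X Y : tight X -> tight Y -> tight (X :|: Y).
  move=> [XW cX sX eX] [YW cY sY eY].
  have UW : X :|: Y \subset W by rewrite subUset XW.
  have cUI := cardsUI X Y.
  have okU : \sum_(x in X :|: Y) dem x <= #|nbh (X :|: Y) :&: U|.
    by apply: okW => //; lia.
  have okI : \sum_(x in X :&: Y) dem x <= #|nbh (X :&: Y) :&: U|.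
    apply: okW; first exact: subset_trans (subsetIl _ _) XW.
    by lia.
  have sumUI : \sum_(x in X :|: Y) dem x + \sum_(x in X :&: Y) dem x =
      \sum_(x in X) dem x + \sum_(x in Y) dem x.
    rewrite (bigID (mem X) (mem Y)) /= [X in X + _](bigID (mem X)) /=.
    rewrite -!addnA; congr (_ + _).
      by apply: eq_bigl => x; rewrite !inE; case: (x \in X); rewrite ?andbF.
    rewrite addnC; congr (_ + _); apply: eq_bigl => x; rewrite !inE.
      by rewrite andbC.
    by case: (x \in X); rewrite ?andbF.
  have nbhUI : #|nbh (X :|: Y) :&: U| + #|nbh (X :&: Y) :&: U| <=
      #|nbh X :&: U| + #|nbh Y :&: U|.
    rewrite nbhU setIUl -[X in _ <= X]cardsUI leq_add2l subset_leq_card //.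
    rewrite setIACA setIid setSI // subsetI.
    by rewrite !nbhS ?subsetIl ?subsetIr.
  have eU : \sum_(x in X :|: Y) dem x = #|nbh (X :|: Y) :&: U| by lia.
  split=> //; last by rewrite inE negb_or sX.
  (* A tight set with at least [m] elements would contradict the strict inequality in [big]. *)
  rewrite ltnNge; apply/negP=> mU.
  by have := big _ UW; rewrite mU => /(_ ltac:(lia)); lia.
have [X [XW cX sX eX] nX] : exists2 X, tight X &
    forall y, y \in enum (U :&: nbh [set s]) -> y \in nbh X.
  have : {subset enum (U :&: nbh [set s]) <= U :&: nbh [set s]}.
    by move=> y; rewrite mem_enum.
  elim: (enum _) => [_|y r IHr sub].
    exists set0 => //; split; rewrite ?sub0set ?cards0 ?inE // big_set0.
    apply/esym/eqP; rewrite cards_eq0 -subset0; apply/subsetP=> y.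
    by rewrite !inE => /andP[/existsP[x]]; rewrite inE.
  have [z zr|X tX nX] := IHr; first by apply: sub; rewrite inE zr orbT.
  have : y \in U :&: nbh [set s] by apply: sub; rewrite mem_head.
  rewrite !inE => /andP[yU /existsP[x /andP[]]]; rewrite inE => /eqP-> esy.
  have [Y tY yY] := tight_y y yU esy.
  exists (X :|: Y); first exact: tightU.
  move=> z; rewrite inE nbhU inE => /orP[/eqP->|/nX->//].
  by rewrite yY orbT.
(* Adding [s] raises the demand of [X] by [dem s > 0] but brings no new neighbour in [U], since
   those of [s] already lie in [nbh X]. *)
have := okW (s |: X); rewrite subUset sub1set sW XW cardsU1 sX => /(_ isT).
move=> /(_ ltac:(lia)); rewrite big_setU1 //= eX nbhU setIUl.
rewrite (_ : _ :|: _ = nbh X :&: U); first by lia.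
apply/setUidPr/subsetP=> y; rewrite inE => /andP[ys yU].
by rewrite inE yU nX // mem_enum inE yU.
Qed.

(* W is the complement of a largest set of size at most 3m that expands badly;
   adding to it a badly expanding subset of W would contradict maximality. *)
Lemma joined_core d m : 0 < m -> joined m -> 3 * (d * m) + 4 * m <= #|V| ->
  exists2 W : {set V}, #|~: W| < m & forall X, X \subset W -> X != set0 ->
    #|X| <= m.*2 -> d * #|X| < #|nbh X :&: W|.
Proof.
move=> m0 jm leV.
(* The bound is [m + m.*2]: the maximal bad set turns out smaller than [m], and a set of size up to
   [m.*2] must still fit beside it. *)
pose P (B : {set V}) := (#|B| <= 3 * m) && (#|nbh B :\: B| <= d * #|B|).
have P0 : P set0.
  rewrite /P cards0 muln0 /= leqn0 cards_eq0 setD0 -subset0.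
  by apply/subsetP=> y; rewrite inE => /existsP[x]; rewrite inE.
case: (@arg_maxnP _ set0 P (fun B => #|B|) P0) => B /andP[cB nB] maxB.
have ltB : #|B| < m.
  (* With [m] or more elements, [B] and its neighbourhood would miss fewer than [m] vertices,
     although bad expansion leaves them at most [(d + 1) * 3m] in total. *)
  rewrite ltnNge; apply/negP=> mB.
  have := joined_nbh jm mB; have := cardsC (nbh B :|: B).
  have : #|nbh B :|: B| = #|nbh B :\: B| + #|B|.
    rewrite -(cardsID B) addnC setDUl setDv setU0.
    by rewrite (_ : _ :&: B = B) //; apply/setIidPr/subsetUr.
  have : d * #|B| <= d * (3 * m) by rewrite leq_mul2l cB orbT.
  by lia.
exists (~: B); rewrite ?setCK // => X XW X0 cX; rewrite ltnNge; apply/negP=> bad.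
have dXB : #|B :|: X| = #|B| + #|X|.
  have := cardsUI B X; rewrite (_ : B :&: X = set0) ?cards0 ?addn0 //.
  by apply/eqP; rewrite setI_eq0 disjoint_sym disjoints_subset.
have : P (B :|: X).
  rewrite /P dXB; apply/andP; split; first by lia.
  rewrite mulnDr; apply: leq_trans (leq_add nB bad).
  apply: leq_trans (leq_card_setU _ _); rewrite subset_leq_card //.
  apply/subsetP=> y; rewrite nbhU !(in_setU, in_setD, in_setI, in_setC).
  by case: (y \in B); case: (y \in X); case: (y \in nbh B); case: (y \in nbh X).
move/maxB => /=; rewrite dXB; move: X0; rewrite -card_gt0.
by lia.
Qed.

(** Friedman-Pippenger embedding: the vertices are placed in order inside the core [W], and
    [demand_step] picks each image so that room for all later children survives. *)
Lemma joined_embed d m K (par : nat -> nat) :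
  0 < m -> joined m -> 0 < K -> K + 3 * (d * m) + 5 * m <= #|V| ->
  (forall j, 0 < j < K -> par j < j) ->
  (forall i, count (fun j => par j == i) (iota 1 K.-1) <= d) ->
  exists phi : nat -> V,
    (forall i j, i < K -> j < K -> phi i = phi j -> i = j) /\
    (forall j, 0 < j < K -> e (phi (par j)) (phi j)).
Proof.
move=> m0 jm K0 leV par_lt kids.
have [W cW expW] := @joined_core d m m0 jm ltac:(lia).
have cWC := cardsC W.
suff /(_ K) [] : forall k, 0 < k <= K -> exists (phi : nat -> V) (U : {set V}) dem,
  [/\ [/\ forall i j, i < k -> j < k -> phi i = phi j -> i = j,
      forall j, 0 < j < k -> e (phi (par j)) (phi j),
      forall i, i < k -> phi i \in W &
      forall i, i < k -> phi i \notin U] &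
      [/\ U \subset W, #|W| <= #|U| + k, demand_ok W U dem m,
      forall v, dem v <= d /\ (v \in U -> dem v = d) &
      forall i, i < k -> count (fun j => par j == i) (iota k (K - k)) <= dem (phi i)]].
- by rewrite K0 leqnn.
- by move=> phi [U [dem [[inj adj _ _] _]]]; exists phi.
elim=> // [[_ _|k IHk kK]].
  have : 0 < #|W| by lia.
  case/card_gt0P=> r rW; exists (fun=> r), (W :\ r), (fun=> d); split; split=> //.
  - by move=> [|i] [|j].
  - by case.
  - by move=> i _; rewrite !inE eqxx.
  - exact: subD1set.
  - by rewrite (cardsD1 r W) rW addnC.
  - move=> X XW cX; rewrite sum_nat_const mulnC.
    have [->|X0] := eqVneq X set0; first by rewrite cards0 muln0.
    (* The strict inequality in [joined_core] pays for the image [r] of the root leaving [U]. *)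
    have := expW X XW X0 cX; rewrite setIDA (cardsD1 r (nbh X :&: W)).
    by case: (r \in _) => /=; lia.
  - by move=> i _; rewrite subn1; apply: kids.
have /IHk [phi [U [dem [[inj adj inW outU] [UW cU ok led dems]]]]] : 0 < k.+1 <= K by lia.
have pk : par k.+1 < k.+1 by apply: par_lt; lia.
pose s := phi (par k.+1).
have iota_k : iota k.+1 (K - k.+1) = k.+1 :: iota k.+2 (K - k.+2).
  by rewrite (_ : K - k.+1 = (K - k.+2).+1) //; lia.
have ds : 0 < dem s.
  by apply: leq_trans (dems _ pk); rewrite iota_k /= eqxx.
(* Here [U] has at least [3dm + 4m] elements. If [X] has between [m] and [2m], fewer than [m]
   vertices escape [X] and its neighbourhood, so more than the [2dm] that [X] may demand remain. *)
have [|y [yU esy ok']] := demand_step m0 ok _ (inW _ pk) ds.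
  move=> X XW /andP[mX cX]; have := joined_nbh jm mX.
  have : \sum_(x in X) dem x <= d * #|X|.
    by rewrite mulnC -sum_nat_const; apply: leq_sum => x _; case: (led x).
  have : #|U| <= #|nbh X :&: U| + (#|X| + #|~: (nbh X :|: X)|).
    apply: leq_trans (leq_add (leqnn _) (leq_card_setU _ _)).
    apply: leq_trans (leq_card_setU _ _); rewrite subset_leq_card //.
    apply/subsetP=> z zU; rewrite !in_setU in_setI in_setC in_setU zU.
    by case: (z \in nbh X); case: (z \in X).
  have : d * #|X| <= d * (2 * m) by rewrite leq_mul2l mul2n cX orbT.
  by lia.
have y_new i : i < k.+1 -> phi i <> y.
  by move=> /outU + phiy; rewrite phiy yU.
have lt_k i : i < k.+2 -> i = k.+1 \/ i < k.+1.
  by rewrite ltnS leq_eqVlt => /orP[/eqP|]; [left | right].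
pose psi i := if i == k.+1 then y else phi i.
have psi_lt i : i < k.+1 -> psi i = phi i.
  by move=> ik; rewrite /psi; case: eqP ik => // -> ; rewrite ltnn.
have psi_k : psi k.+1 = y by rewrite /psi eqxx.
exists psi, (U :\ y), (fun v => dem v - (v == s)); split; split=> //.
- move=> i j /lt_k[->|ik] /lt_k[->|jk] //; rewrite ?psi_k ?psi_lt //.
  + by move=> yj; case: (y_new _ jk).
  + by move=> yi; case: (y_new _ ik).
  by apply: inj.
- move=> j /andP[j0 /lt_k[->|jk]].
    by rewrite psi_k psi_lt.
  rewrite !psi_lt //; first by apply: adj; rewrite j0.
  by apply: (ltn_trans _ jk); apply: par_lt; lia.
- move=> i /lt_k[->|ik].
    by rewrite psi_k (subsetP UW).
  by rewrite psi_lt ?inW.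
- move=> i /lt_k[->|ik].
    by rewrite psi_k !inE eqxx.
  by rewrite psi_lt // inE negb_and outU ?orbT.
- exact: subset_trans (subD1set _ _) UW.
- by move: cU; rewrite (cardsD1 y U) yU; lia.
- move=> v; have [dv dvU] := led v; split; first exact: leq_trans (leq_subr _ _) dv.
  rewrite !inE => /andP[_ vU]; rewrite dvU // (_ : v == s = false) ?subn0 //.
  by apply: contraNF (outU _ pk) => /eqP vs; rewrite -/s -vs.
move=> i /lt_k[->|ik].
  rewrite psi_k (_ : y == s = false) ?subn0; last first.
    by apply/eqP=> ys; case: (y_new _ pk).
  rewrite (led y).2 //; apply: leq_trans (kids k.+1).
  have -> : iota 1 K.-1 = iota 1 k.+1 ++ iota k.+2 (K - k.+2).
    by rewrite -iotaD; congr iota; lia.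
  by rewrite count_cat leq_addl.
rewrite psi_lt //; have := dems i ik; rewrite iota_k /=.
have [<-|] := eqVneq (par k.+1) i; first by rewrite eqxx; lia.
case: (eqVneq (phi i) s) => [/(inj _ _ ik pk) -> /eqP//|_ _].
by rewrite subn0.
Qed.

End JoinedGraphs.

(** * Parent functions and absorption *)

Section ParentTrees.
Variables (par : nat -> nat) (n : nat).
Hypothesis par_lt : forall j, 0 < j < n -> par j < j.
Implicit Types (i j t q : nat) (S : seq nat).

(** A vertex [j > 0] hangs from [par j]; the guards are there because [par 0] carries no meaning. *)
Definition tadj i j := (0 < j) && (par j == i) || (0 < i) && (par i == j).

Definition nbs t := [seq q <- iota 0 n | tadj t q].

Definition star t := t :: nbs t.

Lemma tadjC i j : tadj i j = tadj j i.
Proof. by rewrite /tadj orbC. Qed.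

Lemma tadj_irr i : i < n -> tadj i i = false.
Proof.
move=> ltin; rewrite /tadj orbb; case: i ltin => // i ltin /=.
by have := par_lt (j := i.+1) ltin; lia.
Qed.

Lemma mem_nbs t q : (q \in nbs t) = (q < n) && tadj t q.
Proof. by rewrite mem_filter mem_iota add0n andbC. Qed.

Lemma mem_starC t q : t < n -> q < n -> (t \in star q) = (q \in star t).
Proof. by move=> tn qn; rewrite !inE !mem_nbs tn qn tadjC eq_sym. Qed.

Lemma star_lt t q : t < n -> q \in star t -> q < n.
Proof. by move=> tn; rewrite inE mem_nbs => /orP[/eqP->|/andP[]]. Qed.

Lemma star_uniq t : t < n -> uniq (star t).
Proof.
move=> tn; rewrite /= mem_nbs tn tadj_irr //=.
by rewrite filter_uniq ?iota_uniq.
Qed.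

(** Besides at most [d] children there is only the parent. *)
Lemma size_nbs d t : count (fun j => par j == t) (iota 1 n.-1) <= d ->
  size (nbs t) <= d.+1.
Proof.
move=> kids.
have : size (nbs t) <= size (par t :: [seq j <- iota 1 n.-1 | par j == t]).
  apply: uniq_leq_size; first by rewrite filter_uniq ?iota_uniq.
  move=> q; rewrite mem_nbs inE mem_filter mem_iota /tadj => /andP[qn].
  case/orP=> /andP[q0 /eqP->]; rewrite eqxx ?orbT //=.
  by apply/orP; right; lia.
by move/leq_trans; apply; rewrite /= size_filter.
Qed.

Definition inner K := [seq t <- iota 0 K | all (fun q => q < K) (nbs t)].

(** A vertex below [K] that is not inner is the parent of one of the [n - K] vertices from [K]
    on. *)
Lemma size_inner K : K <= n -> K <= size (inner K) + (n - K).
Proof.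
move=> Kn; pose a t := all (fun q => q < K) (nbs t).
have := count_predC a (iota 0 K); rewrite size_iota.
suff : count (predC a) (iota 0 K) <= n - K by rewrite /inner size_filter -/a; lia.
rewrite -size_filter -[leqRHS](size_iota K) -[leqRHS](size_map par).
apply: uniq_leq_size; first by rewrite filter_uniq ?iota_uniq.
move=> t; rewrite mem_filter mem_iota /= => /andP[/allPn[q]].
rewrite mem_nbs -leqNgt /tadj => /andP[qn tq] Kq tK; apply/mapP; exists q.
  by rewrite mem_iota; lia.
case/orP: tq => /andP[t0 /eqP] //; have := par_lt (j := t).
by move: t0 tK Kq Kn; lia.
Qed.

Lemma uniq_flatten_star S : {subset S <= gtn n} -> uniq S ->
  {in S &, forall t t', t != t' -> ~~ has (mem (star t)) (star t')} ->
  uniq (flatten (map star S)).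
Proof.
elim: S => // t S IHS sub /andP[tS uS] dis.
rewrite -[flatten _]/(star t ++ flatten (map star S)) cat_uniq star_uniq; last first.
  by apply: sub; rewrite mem_head.
rewrite IHS //=; first last.
- by move=> x y xS yS; apply: dis; rewrite inE ?xS ?yS orbT.
- by move=> x xS; apply: sub; rewrite inE xS orbT.
rewrite andbT; apply/hasPn=> x /flattenP[_ /mapP[y yS ->]] xy.
have ty : t != y by apply: contraNneq tS => ->.
have yt : y \in t :: S by rewrite inE yS orbT.
by have /hasPn/(_ x xy) := dis t y (mem_head _ _) yt ty.
Qed.

(** Greedy choice: a star that meets a chosen star has its centre in the star of some vertex of the
    latter, so each choice excludes at most [(d + 2) ^ 2] centres. *)
Lemma disjoint_stars d K s : K <= n ->
  (forall t, count (fun j => par j == t) (iota 1 n.-1) <= d) ->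
  s * (d + 2) ^ 2 + (n - K) <= K ->
  exists S, [/\ size S = s, uniq S, {subset S <= inner K} &
    {in S &, forall t t', t != t' -> ~~ has (mem (star t)) (star t')}].
Proof.
move=> Kn kids.
have inner_lt t : t \in inner K -> t < n.
  by rewrite mem_filter mem_iota => /and3P[_ _]; lia.
have size_star t : size (star t) <= d + 2.
  by have := size_nbs (kids t); rewrite /=; lia.
have size_stars (r : seq nat) : size (flatten (map star r)) <= size r * (d + 2).
  elim: r => //= t r IHr; rewrite size_cat mulSn.
  by move: (size_star t) => /=; lia.
elim: s => [_|s IHs sK]; first by exists [::].
have [|S [sS uS subS disS]] := IHs; first by rewrite mulSn in sK; lia.
pose conf := flatten (map star (flatten (map star S))).
have size_conf : size conf <= s * (d + 2) ^ 2.
  apply: leq_trans (size_stars _) _; rewrite expnS expn1 mulnA leq_mul2r.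
  by rewrite -sS size_stars orbT.
have /allPn[t tK tconf] : ~~ all (mem conf) (inner K).
  apply/negP=> /allP sub.
  have : size (inner K) <= size conf.
    by apply: uniq_leq_size => //; rewrite filter_uniq ?iota_uniq.
  have : 0 < (d + 2) ^ 2 by rewrite expn_gt0 addn2.
  by have := size_inner Kn; rewrite mulSn in sK; lia.
have tn := inner_lt t tK.
have dis_t t' : t' \in S -> ~~ has (mem (star t)) (star t').
  move=> t'S; apply: contra tconf => /hasP[z zt' zt].
  have t'n := inner_lt _ (subS _ t'S); have zn := star_lt t'n zt'.
  apply/flattenP; exists (star z); last by rewrite mem_starC.
  by apply: map_f; apply/flattenP; exists (star t') => //; apply: map_f.
exists (t :: S); split; first by rewrite /= sS.
- rewrite /= uS andbT; apply/negP=> /dis_t/hasPn/(_ t).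
  by rewrite !inE eqxx => /(_ isT).
- by move=> x; rewrite inE => /orP[/eqP->|/subS].
move=> x y; rewrite !inE => /orP[/eqP->|xS] /orP[/eqP->|yS] //.
- by rewrite eqxx.
- by move=> _; apply: dis_t.
- by move=> _; rewrite has_sym; apply: dis_t.
exact: disS.
Qed.

(* A new leaf k is attached to its parent p although phi p may have no free
   neighbour: a vertex t whose image is a g-neighbour of phi p, and whose
   neighbours are all mapped to g-neighbours of an unused vertex u, moves to u
   and k takes its former place. *)
Lemma absorb_leaves (V : finType) (H g : rel V) K S (phi0 : nat -> V) :
  #|V| = n -> 0 < K <= n -> symmetric H -> irreflexive g -> subrel g H ->
  (forall i j, i < K -> j < K -> phi0 i = phi0 j -> i = j) ->
  (forall i j, i < K -> j < K -> tadj i j -> H (phi0 i) (phi0 j)) ->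
  uniq S -> {subset S <= inner K} -> {in S &, forall t q, ~~ tadj t q} ->
  (forall u v, n - K <= count (fun t => g v (phi0 t) &&
     all (fun q => g u (phi0 q)) (nbs t)) S) ->
  exists phi : nat -> V,
    (forall i j, i < n -> j < n -> phi i = phi j -> i = j) /\
    (forall i j, i < n -> j < n -> tadj i j -> H (phi i) (phi j)).
Proof.
move=> cV /andP[K0 Kn] symH irrg gH inj0 hom0 uS subS indS rich.
(* [C] lists the vertices that have moved, at most one for each vertex added. *)
suff /(_ n) [] : forall k, K <= k <= n -> exists (phi : nat -> V) (C : seq nat),
  [/\ forall i j, i < k -> j < k -> phi i = phi j -> i = j,
      forall i j, i < k -> j < k -> tadj i j -> H (phi i) (phi j),
      {subset C <= S}, size C <= k - K &
      forall t, t < K -> t \notin C -> phi t = phi0 t].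
- by rewrite Kn leqnn.
- by move=> phi [C [inj hom _ _ _]]; exists phi.
elim=> [|k IHk] /andP[Kk kn]; first by lia.
move: Kk; rewrite leq_eqVlt => /orP[/eqP <-|Kk].
  by exists phi0, [::]; split=> //; rewrite subnn.
have [|phi [C [inj hom CS cC phiE]]] := IHk; first by lia.
have [u uphi] : exists u, u \notin [seq phi i | i <- iota 0 k].
  case: (pickP (fun u => u \notin [seq phi i | i <- iota 0 k])) => [u|all_in].
    by exists u.
  have : #|V| <= size [seq phi i | i <- iota 0 k].
    apply: leq_trans (card_size _); apply/subset_leq_card/subsetP=> x _.
    by have /negbFE := all_in x.
  by rewrite size_map size_iota; lia.
have u_new i : i < k -> phi i <> u.
  move=> ik phiu; move/negP: uphi; apply; apply/mapP; exists i => //.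
  by rewrite mem_iota.
have pk : par k < k by apply: par_lt; lia.
set good := fun t => g (phi (par k)) (phi0 t) && all (fun q => g u (phi0 q)) (nbs t).
(* At least [n - K] vertices of [S] are suitable and at most [k - K] have moved, so a suitable one
   is left. *)
have /allPn[t] : ~~ all (mem C) (filter good S).
  apply/negP=> /allP sub.
  have : size (filter good S) <= size C.
    by apply: uniq_leq_size => //; rewrite filter_uniq.
  by have := rich u (phi (par k)); rewrite size_filter -/good; lia.
rewrite mem_filter => /andP[/andP[gt /allP nbt] tS] tC.
have /subS := tS; rewrite mem_filter mem_iota => /andP[/allP nbK tK].
have phit := phiE t tK tC.
(* Otherwise [phi (par k)] would be a [g]-neighbour of itself. *)
have tp : par k <> t by move=> pt; rewrite pt phit irrg in gt.
have kt : k <> t by lia.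
pose psi i := if i == k then phi t else if i == t then u else phi i.
have psi_k : psi k = phi t by rewrite /psi eqxx.
have psi_t : psi t = u by rewrite /psi eqxx; case: eqP => // tk; case: kt.
have psi_lt i : i < k -> i <> t -> psi i = phi i.
  by move=> ik it; rewrite /psi (ltn_eqF ik); case: eqP.
have cases i : i < k.+1 -> [\/ i = k, i = t | i < k /\ i <> t].
  rewrite ltnS leq_eqVlt => /orP[/eqP|ik]; first by constructor 1.
  by have [->|/eqP it] := eqVneq i t; [constructor 2 | constructor 3].
have nb_k j : j < k -> tadj k j -> j = par k.
  move=> jk /orP[/andP[j0 /eqP pj]|/andP[_ /eqP->] //].
  by have := par_lt (j := j); lia.
(* [S] is independent, so no neighbour of [t] has ever moved: all are still at their places under
   [phi0], which are [g]-neighbours of [u]. *)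
have nb_t q : q < n -> tadj t q -> q < K /\ g u (phi q).
  move=> qn tq; have qt : q \in nbs t by rewrite mem_nbs qn.
  have qK := nbK _ qt; split=> //; rewrite phiE ?nbt //.
  by apply/negP=> /CS qS; have := indS _ _ tS qS; rewrite tq.
have [tk kk] : t < k /\ k < n by lia.
exists psi, (t :: C); split.
- have aux i j : i < k.+1 -> j < k -> j <> t -> psi i = psi j -> i = j.
    move=> /cases ci jk jt; rewrite (psi_lt j) //; case: ci => [->|->|[ik it]].
    + by rewrite psi_k => /(inj _ _ tk jk) tj; case: jt.
    + by rewrite psi_t => uj; case: (u_new j).
    + by rewrite psi_lt // => /(inj _ _ ik jk).
  move=> i j ilt jlt; case: (cases i ilt) (cases j jlt) => [ei|ei|[ik it]].
  + case=> [->//|ej|[jk jt]]; last by apply: aux.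
    by rewrite ei ej psi_k psi_t => /(u_new _ tk).
  + case=> [ej|->//|[jk jt]]; last by apply: aux.
    by rewrite ei ej psi_k psi_t => /esym/(u_new _ tk).
  + by move=> _ /esym/(aux _ _ jlt ik it).
- move=> i j ilt jlt; case: (cases i ilt) (cases j jlt) => [->|->|[ik it]].
  + case=> [->|->|[jk jt]]; first by rewrite tadj_irr.
      by rewrite tadjC => /nb_t[//|]; lia.
    by move=> /nb_k-> //; rewrite psi_k psi_lt // symH phit; apply: gH.
  + case=> [->|->|[jk jt]]; first by move=> /nb_t[//|]; lia.
      by rewrite tadj_irr //; lia.
    by move=> /nb_t[|_ gu]; [lia | rewrite psi_t psi_lt //; apply: gH].
  + case=> [->|->|[jk jt]]; last by rewrite !psi_lt //; apply: hom.
      by rewrite tadjC => /nb_k-> //; rewrite psi_k psi_lt // phit; apply: gH.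
    rewrite tadjC => /nb_t[|_ gu]; first by lia.
    by rewrite psi_t psi_lt // symH; apply: gH.
- by move=> x; rewrite inE => /orP[/eqP->|/CS].
- by rewrite /=; lia.
move=> i iK; rewrite inE negb_or => /andP[/eqP it iC].
by rewrite psi_lt ?phiE //; lia.
Qed.

End ParentTrees.

(** * Random permutations *)

Section RandomPermutations.
Local Open Scope ring_scope.
Variables (R : realFieldType) (T : finType).
Implicit Types (P : seq T) (F : {perm T} -> R) (L : seq (T * {set T})).

Definition depends_on P F :=
  forall p q : {perm T}, {in P, p =1 q} -> F p = F q.

Definition fits L (p : {perm T}) := all (fun x : T * {set T} => p x.1 \in x.2) L.

(* Composing p with the transposition of a and b does not change F, so every b
   outside P is as likely as a to be sent into A. *)
Lemma perm_point_prob P F a (A : {set T}) (theta : R) :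
  (forall p, 0 <= F p) -> depends_on P F -> a \notin P ->
  theta * #|T|%:R + (size P)%:R <= #|A|%:R ->
  theta * (\sum_p F p) <= \sum_p F p * (p a \in A)%:R.
Proof.
move=> F0 locF aP le_theta.
pose Q := [set b | b \notin P].
have swap b : b \in Q ->
    \sum_p F p * (p b \in A)%:R = \sum_p F p * (p a \in A)%:R.
  rewrite inE => bP; rewrite (reindex_inj (mulgI (tperm a b))) /=.
  apply: eq_bigr => p _; rewrite permM tpermR; congr (_ * _).
  apply: locF => x xP; rewrite permM tpermD //.
    by apply: contraNneq aP => ->.
  by apply: contraNneq bP => ->.
have T0 : (0 : R) < #|T|%:R by rewrite ltr0n; apply/card_gt0P; exists a.
have S0 : 0 <= \sum_p F p by apply: sumr_ge0.
have Sa0 : 0 <= \sum_p F p * (p a \in A)%:R.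
  by apply: sumr_ge0 => p _; rewrite mulr_ge0 ?ler0n.
rewrite -(ler_pM2l T0); apply: le_trans (_ : #|Q|%:R * _ <= _); last first.
  by apply: ler_wpM2r => //; rewrite ler_nat max_card.
have -> : #|Q|%:R * (\sum_p F p * (p a \in A)%:R) =
    \sum_p F p * #|[set b in Q | p b \in A]|%:R.
  transitivity (\sum_(b in Q) \sum_p F p * (p b \in A)%:R).
    by rewrite (eq_bigr _ swap) sumr_const mulr_natl.
  rewrite exchange_big /=; apply: eq_bigr => p _.
  rewrite -mulr_sumr; congr (_ * _).
  rewrite -sum1_card natr_sum [RHS]big_mkcond [LHS]big_mkcond /=.
  by apply: eq_bigr => b _; rewrite !inE; case: (b \notin P); case: (p b \in A).
rewrite mulrCA mulrA mulr_sumr; apply: ler_sum => p _; rewrite mulrC.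
apply: ler_wpM2l => //.
(* Of the [#|A|] points that [p] sends into [A], at most [size P] lie outside [Q]. *)
have : (#|A| <= #|[set b in Q | p b \in A]| + size P)%N.
  have -> : #|A| = #|[set b | p b \in A]|.
    rewrite -(card_imset _ (@perm_inj _ (p^-1)%g)); apply: eq_card => b.
    apply/imsetP/idP => [[x xA ->]|]; rewrite inE ?permKV // => pbA.
    by exists (p b) => //; rewrite permK.
  apply: leq_trans (_ : _ <= #|[set b in Q | p b \in A] :|: [set b in P]|)%N _.
    apply: subset_leq_card; apply/subsetP=> b; rewrite !inE => ->.
    by rewrite andbT orNb.
  apply: leq_trans (leq_card_setU _ _) _; rewrite leq_add2l.
  by rewrite cardsE card_size.
rewrite -(ler_nat R) natrD => leA.
have := le_trans le_theta leA; rewrite lerD2r; apply: le_trans.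
by rewrite mulrC.
Qed.

Lemma depends_on_fits P F L : depends_on P F ->
  depends_on (map fst L ++ P) (fun p => F p * (fits L p)%:R).
Proof.
move=> locF p q eqpq; congr (_ * _).
  by apply: locF => x xP; apply: eqpq; rewrite mem_cat xP orbT.
congr ((nat_of_bool _)%:R); apply: eq_in_all => x xL.
by rewrite eqpq // mem_cat map_f.
Qed.

(** The points are exposed one at a time: the indicator of each success moves into the weight [F],
    and the point into [P]. As [M] bounds the number of points ever exposed, each success keeps
    conditional probability at least [theta]. *)
Lemma perm_fits_prob P F L (theta M : R) :
  0 <= theta -> (forall p, 0 <= F p) -> depends_on P F -> uniq (map fst L ++ P) ->
  (size P + size L)%:R <= M ->
  (forall x, x \in L -> theta * #|T|%:R + M <= #|x.2|%:R) ->
  theta ^+ size L * (\sum_p F p) <= \sum_p F p * (fits L p)%:R.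
Proof.
move=> th0; elim: L => [|[a A] L IHL] in P F * => F0 locF uL sM le_theta.
  by rewrite mul1r; apply: ler_sum => p _; rewrite mulr1.
move: uL; rewrite /= mem_cat negb_or => /andP[/andP[aL aP] uL].
have -> : \sum_p F p * (fits ((a, A) :: L) p)%:R =
    \sum_p (F p * (p a \in A)%:R) * (fits L p)%:R.
  by apply: eq_bigr => p _; rewrite -mulrA -natrM mulnb.
have F'0 p : 0 <= F p * (p a \in A)%:R by rewrite mulr_ge0 ?ler0n.
have loc' : depends_on (a :: P) (fun p => F p * (p a \in A)%:R).
  move=> p q eqpq; rewrite (locF p q); last first.
    by move=> x xP; apply: eqpq; rewrite inE xP orbT.
  by rewrite eqpq ?mem_head.
have uL' : uniq (map fst L ++ a :: P).
  by rewrite -[a :: P]/([:: a] ++ P) uniq_catCA /= mem_cat negb_or aL aP.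
apply: le_trans (IHL (a :: P) _ F'0 loc' uL' _ _).
- rewrite exprSr -mulrA; apply: ler_wpM2l; first exact: exprn_ge0.
  apply: (@perm_point_prob P) => //.
  apply: le_trans (le_theta (a, A) (mem_head _ _)).
  rewrite lerD2l; apply: le_trans sM; rewrite ler_nat; exact: leq_addr.
- by apply: le_trans sM; rewrite ler_nat /= addSnnS.
- by move=> x xL; apply: le_theta; rewrite inE xL orbT.
Qed.

(** The lists use disjoint points and are exposed one after the other. Each fits with conditional
    probability at least [theta ^+ d], and fitting halves the weight, whence a factor of at most
    [1 - theta ^+ d / 2] per list. *)
Lemma perm_fits_expmoment P F (LL : seq (seq (T * {set T}))) (theta M : R) d :
  0 <= theta <= 1 -> (forall p, 0 <= F p) -> depends_on P F ->
  uniq (flatten (map (map fst) LL) ++ P) ->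
  (size P + size (flatten LL))%:R <= M ->
  (forall L, L \in LL -> (size L <= d)%N) ->
  (forall x, x \in flatten LL -> theta * #|T|%:R + M <= #|x.2|%:R) ->
  \sum_p F p * 2^-1 ^+ count (fits^~ p) LL
    <= (1 - theta ^+ d / 2) ^+ size LL * (\sum_p F p).
Proof.
move=> /andP[th0 th1]; elim: LL => [|L LL IHL] in P F * => F0 locF uL sM sL le_theta.
  by rewrite mul1r; apply: ler_sum => p _; rewrite expr0 mulr1.
pose F' p := F p * (1 - (fits L p)%:R / 2).
have -> : \sum_p F p * 2^-1 ^+ count (fits^~ p) (L :: LL) =
    \sum_p F' p * 2^-1 ^+ count (fits^~ p) LL.
  apply: eq_bigr => p _; rewrite /F' /= -mulrA; congr (_ * _).
  case: (fits L p); rewrite /= ?add0n ?mul0r ?subr0 ?mul1r // add1n exprS.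
  by congr (_ * _); lra.
have F'0 p : 0 <= F' p.
  by rewrite mulr_ge0 //; case: (fits L p); rewrite /=; lra.
have loc' : depends_on (map fst L ++ P) F'.
  move=> p q eqpq; have := depends_on_fits locF eqpq.
  have FE : F p = F q by apply: locF => x xP; apply: eqpq; rewrite mem_cat xP orbT.
  by rewrite /F' !mulrBr !mulrA FE => ->.
have uL' : uniq (flatten (map (map fst) LL) ++ (map fst L ++ P)).
  by rewrite uniq_catCA catA.
have sM' : (size (map fst L ++ P) + size (flatten LL))%:R <= M.
  apply: le_trans sM; rewrite ler_nat size_cat size_map /= size_cat; lia.
apply: le_trans (IHL _ _ F'0 loc' uL' sM' _ _) _.
- by move=> L' L'in; apply: sL; rewrite inE L'in orbT.
- by move=> x xin; apply: le_theta; rewrite /= mem_cat xin orbT.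
rewrite exprSr -mulrA; apply: ler_wpM2l.
  apply: exprn_ge0; have := exprn_ile1 d th0 th1; lra.
have : theta ^+ size L * (\sum_p F p) <= \sum_p F p * (fits L p)%:R.
  apply: (@perm_fits_prob P F L theta M) => //.
  - by move: uL; rewrite /= -catA uniq_catCA cat_uniq => /and3P[].
  - by apply: le_trans sM; rewrite ler_nat /= size_cat; lia.
  - by move=> x xL; apply: le_theta; rewrite /= mem_cat xL.
have S0 : 0 <= \sum_p F p by apply: sumr_ge0.
have : theta ^+ d * (\sum_p F p) <= theta ^+ size L * (\sum_p F p).
  by apply: ler_wpM2r => //; apply: ler_wiXn2l => //; apply: sL; rewrite mem_head.
have -> : \sum_p F' p = \sum_p F p - (\sum_p F p * (fits L p)%:R) / 2.
  rewrite mulr_suml -sumrB; apply: eq_bigr => p _.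
  by rewrite /F' mulrBr mulr1 mulrA.
by lra.
Qed.

(** Markov's inequality for the exponential moment: on the event counted, [2 ^+ k * 2^-1 ^+ count]
    is at least 1. *)
Lemma perm_fits_tail (LL : seq (seq (T * {set T}))) (theta M : R) d k :
  0 <= theta <= 1 -> uniq (flatten (map (map fst) LL)) ->
  (size (flatten LL))%:R <= M ->
  (forall L, L \in LL -> (size L <= d)%N) ->
  (forall x, x \in flatten LL -> theta * #|T|%:R + M <= #|x.2|%:R) ->
  (#|[set p : {perm T} | count (fits^~ p) LL < k]%N|%:R : R)
    <= 2 ^+ k * (1 - theta ^+ d / 2) ^+ size LL * #|{perm T}|%:R.
Proof.
move=> th uL sM sL le_theta.
have := @perm_fits_expmoment [::] (fun=> 1) LL theta M d th (fun=> ler01)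
  (fun _ _ _ => erefl).
rewrite cats0 => /(_ uL sM sL le_theta) expm.
rewrite -mulrA; apply: le_trans (ler_wpM2l _ (le_trans expm _)); first last.
- by rewrite sumr_const.
- by apply: exprn_ge0.
rewrite mulr_sumr -sum1_card natr_sum big_mkcond; apply: ler_sum => p _.
rewrite inE mul1r exprVn; case: ifP => [ltk|_]; last by rewrite divr_ge0 ?exprn_ge0.
rewrite ler_pdivlMr ?exprn_gt0 // mul1r; apply: ler_weXn2l; last exact: ltnW.
by lra.
Qed.

End RandomPermutations.

(** * Ordering a tree *)

Section TreeOrder.
Variables (V : finType) (T : sgraph V).
Implicit Types (x y z : V) (s : seq V).

Lemma adjC : symmetric (adj T).
Proof. by move=> x y; rewrite /adj setUC. Qed.

Lemma adj_irr : irreflexive (adj T).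
Proof.
move=> x; apply/negP; rewrite /adj setUid.
by move/(forall_inP (edges_card2 T)); rewrite cards1.
Qed.

Definition adj_in s : rel V := fun x y => [&& adj T x y, x \in s & y \in s].

(** If [x] and [x'] differed, a simple path between them inside [s] would close up through [y] to a
    cycle with at least three vertices. *)
Lemma acyclic_uniq_nbr s x x' y : acyclic_graph T ->
  {in s &, forall a b, connect (adj_in s) a b} ->
  x \in s -> x' \in s -> y \notin s -> adj T x y -> adj T x' y -> x = x'.
Proof.
move=> acyc conn xs x's ys xy x'y; apply/eqP/negPn/negP=> neq.
have /connectP[p0 path0 last0] := conn x x' xs x's.
case/shortenP: path0 last0 => p pathp up _ lastp.
have [adjp allp] : path (adj T) x p /\ all (mem s) p.
  elim: p x {xs xy neq up lastp} pathp => //= b p IHp x /andP[/and3P[xb xs bs]].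
  by move=> /IHp[-> ->]; rewrite xb bs.
apply: (acyc [:: y, x & p]).
  by case: p lastp {up adjp allp pathp} => //= xx'; rewrite xx' eqxx in neq.
apply/andP; split; rewrite /= ?rcons_path ?adjp -?lastp ?x'y ?[adj T y x]adjC ?xy //.
rewrite -[_ && uniq p]/(uniq (x :: p)) up andbT inE negb_or.
apply/andP; split; first by apply: contraNneq ys => ->.
by apply: contra ys => /(allP allp).
Qed.

Lemma path_exit s x p : path (adj T) x p -> x \in s -> last x p \notin s ->
  exists2 a, a \in s & exists2 b, b \notin s & adj T a b.
Proof.
elim: p x => [|b p IHp] x /=; first by move=> _ ->.
move=> /andP[xb pathp] xs; have [bs|bs _] := boolP (b \in s); first exact: IHp.
by exists x => //; exists b.
Qed.

Definition one_back s := forall x0 j, 0 < j < size s ->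
  exists2 i, i < j & forall i', i' < j ->
    adj T (nth x0 s i') (nth x0 s j) = (i' == i).

(** Starting from one vertex, a vertex adjacent to the current connected set is appended each time;
    by acyclicity it has only one neighbour there. *)
Lemma tree_order : is_tree T ->
  exists s, [/\ uniq s, size s = #|V| & one_back s].
Proof.
move=> [[V0 conT] acyc].
suff /(_ #|V|) [] : forall k, 0 < k <= #|V| -> exists s,
  [/\ uniq s, size s = k, one_back s &
      {in s &, forall x y, connect (adj_in s) x y}].
- by rewrite V0 leqnn.
- by move=> s [us cs ob _]; exists s.
elim=> // [[_ _|k IHk kV]].
  case/card_gt0P: V0 => r _; exists [:: r]; split=> //.
    by move=> x0 [|j] //=; rewrite ltnS ltn0 andbF.
  by move=> x y; rewrite !inE => /eqP-> /eqP->.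
have [|s [us cs ob conn]] := IHk; first by lia.
have [x xs [y ys xy]] : exists2 x, x \in s & exists2 y, y \notin s & adj T x y.
  have [z zs] : exists z, z \notin s.
    case: (pickP (fun z => z \notin s)) => [z|all_in]; first by exists z.
    have : #|V| <= size s.
      apply: leq_trans (card_size _); apply/subset_leq_card/subsetP=> v _.
      by have /negbFE := all_in v.
    by rewrite cs; lia.
  have [r rs] : exists r, r \in s.
    by case: s cs {us ob conn zs} => // r s _; exists r; rewrite mem_head.
  have /connectP[p pathp lastp] := conT r z.
  by apply: (path_exit pathp rs); rewrite -lastp.
exists (rcons s y); split.
- by rewrite rcons_uniq ys.
- by rewrite size_rcons cs.
- move=> x0 j; rewrite size_rcons ltnS cs => /andP[j0].
  rewrite leq_eqVlt => /orP[/eqP->|jk].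
    exists (index x s); first by rewrite -cs index_mem.
    move=> i' i'k; rewrite !nth_rcons cs ltnn eqxx i'k.
    have i's : nth x0 s i' \in s by rewrite mem_nth ?cs.
    apply/idP/eqP => [xy'|->]; last by rewrite nth_index.
    rewrite (acyclic_uniq_nbr acyc conn xs i's ys xy xy').
    by rewrite index_uniq ?cs.
  have [i ij iP] : exists2 i, i < j & forall i', i' < j ->
      adj T (nth x0 s i') (nth x0 s j) = (i' == i) by apply: ob; rewrite j0 cs.
  exists i => // i' i'j; rewrite !nth_rcons cs jk (ltn_trans i'j jk); exact: iP.
have sub : subrel (adj_in s) (adj_in (rcons s y)).
  by move=> a b /and3P[ab as_ bs]; rewrite /adj_in ab !mem_rcons !inE as_ bs !orbT.
have connS a b : a \in s -> b \in s -> connect (adj_in (rcons s y)) a b.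
  move=> as_ bs; apply: connect_sub (conn a b as_ bs) => u v /sub.
  exact: connect1.
have exy : adj_in (rcons s y) x y.
  by rewrite /adj_in xy !mem_rcons !inE xs eqxx orbT.
have eyx : adj_in (rcons s y) y x by rewrite /adj_in adjC andbA andbAC -andbA.
move=> a b; rewrite !mem_rcons !inE => /orP[/eqP->|as_] /orP[/eqP->|bs].
- exact: connect0.
- exact: connect_trans (connect1 eyx) (connS _ _ xs bs).
- exact: connect_trans (connS _ _ as_ xs) (connect1 exy).
- exact: connS.
Qed.

Lemma tree_par d : is_tree T -> (forall x, deg T x <= d) ->
  exists (par : nat -> nat) (idx : V -> nat),
  [/\ forall j, 0 < j < #|V| -> par j < j,
      forall t, count (fun j => par j == t) (iota 1 #|V|.-1) <= d,
      injective idx, forall x, idx x < #|V| &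
      forall x y, adj T x y -> tadj par (idx x) (idx y)].
Proof.
move=> treeT degT; have [s [us cs ob]] := tree_order treeT.
have [[V0 _] _] := treeT; case/card_gt0P: V0 => x0 _.
have s_in x : x \in s.
  have [_ ->] := @uniq_min_size _ s (enum V) us (fun x _ => mem_enum V x)
    ltac:(by rewrite -cardE cs).
  by rewrite mem_enum.
pose nbr j v := adj T v (nth x0 s j); pose par j := find (nbr j) s.
have parP j : 0 < j < #|V| ->
    par j < j /\ forall i, i < j -> adj T (nth x0 s i) (nth x0 s j) = (i == par j).
  rewrite -cs => jn; have [i ij iP] := ob x0 j jn.
  have le_i : par j <= i.
    rewrite leqNgt; apply/negP=> /(before_find x0).
    by rewrite /nbr iP // eqxx.
  have lt_j := leq_ltn_trans le_i ij.
  have : nbr j (nth x0 s (par j)) by rewrite nth_find // has_find -/(par j); lia.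
  by rewrite /nbr iP // => /eqP->.
exists par, (index^~ s); split.
- by move=> j /parP[].
- move=> t.
  apply: leq_trans (degT (nth x0 s t)); rewrite /deg -size_filter cardE.
  rewrite -(size_map (nth x0 s)); apply: uniq_leq_size.
    rewrite map_inj_in_uniq ?filter_uniq ?iota_uniq // => i j.
    rewrite !mem_filter !mem_iota => /andP[_ i_in] /andP[_ j_in] /eqP.
    by rewrite nth_uniq ?cs //; [move/eqP | lia | lia].
  move=> y /mapP[j]; rewrite mem_filter mem_iota => /andP[/eqP <- j_in] ->.
  have [|lt_j adj_j] := parP j; first by lia.
  by rewrite mem_enum inE adj_j.
- by move=> x y /(congr1 (nth x0 s)); rewrite !nth_index.
- by move=> x; rewrite -cs index_mem.
move=> x y xy.
have aux u v : adj T u v -> index u s < index v s -> tadj par (index u s) (index v s).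
  move=> uv lt_uv; have v_lt : index v s < #|V| by rewrite -cs index_mem.
  have [|_ adj_v] := parP (index v s); first by lia.
  have := adj_v _ lt_uv; rewrite !nth_index // uv => /esym/eqP ->.
  by rewrite /tadj eqxx andbT; apply/orP; left; lia.
case: (ltngtP (index x s) (index y s)) => [lt|lt|eq].
- exact: aux.
- by rewrite tadjC; apply: aux => //; rewrite adjC.
by move/(congr1 (nth x0 s)): eq; rewrite !nth_index // => eq; rewrite eq adj_irr in xy.
Qed.

End TreeOrder.

(** * The binomial random graph *)

Section BinomialRandomGraph.
Local Open Scope ring_scope.
Variables (R : realType) (n : nat).
Implicit Types (p : R) (H : sgraph 'I_n) (pi : {perm 'I_n}) (A B : {set 'I_n}).

Lemma sum_sgraph (F : {set {set 'I_n}} -> R) :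
  \sum_H F (edges H) = \sum_(J : {set {set 'I_n}} | [forall e in J, #|e| == 2%N]) F J.
Proof.
have no_edges : [forall e in (set0 : {set {set 'I_n}}), #|e| == 2%N].
  by apply/forall_inP=> e; rewrite inE.
rewrite (reindex_onto (@edges 'I_n) (insubd (SGraph no_edges))) /=; last first.
  by move=> J J2; rewrite insubdK.
by apply: eq_bigl => H; rewrite edges_card2 valKd eqxx.
Qed.

Lemma gnp_avoid p (Fb : {set {set 'I_n}}) :
  (forall e, e \in Fb -> #|e| = 2%N) ->
  gnp_prob p (fun H => [disjoint edges H & Fb]) = (1 - p) ^+ #|Fb|.
Proof.
move=> Fb2; rewrite /gnp_prob /gnp_mass big_mkcond /=.
rewrite (sum_sgraph (fun J => if [disjoint J & Fb] then
  \prod_(e : {set 'I_n} | #|e| == 2%N) (if e \in J then p else 1 - p) else 0)).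
(* [f] and [g] are the weights of [e] being present and absent. The zeros of [f] kill every [J] that
   is no graph or meets [Fb], while [f e + g e] is [1 - p] on [Fb] and 1 elsewhere. *)
pose f (e : {set 'I_n}) : R := if (#|e| == 2%N) && (e \notin Fb) then p else 0.
pose g (e : {set 'I_n}) : R := if #|e| == 2%N then 1 - p else 1.
transitivity (\prod_e (f e + g e)); last first.
  rewrite -prodr_const [RHS]big_mkcond; apply: eq_bigr => e _; rewrite /f /g.
  case: (boolP (e \in Fb)) => [/Fb2 ->|_]; first by rewrite /= add0r.
  by case: (_ == _); rewrite /= ?add0r // addrC subrK.
rewrite (bigA_distr _ _ f g) [LHS]big_mkcond; apply: eq_bigr => J _ /=.
case: (boolP [forall e in J, #|e| == 2%N]) => [/forall_inP J2|]; last first.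
  case/forallPn=> e; rewrite negb_imply => /andP[eJ e2].
  by rewrite (bigD1 e) //= eJ /f (negPf e2) mul0r.
case: ifP => [dis|/negbT]; last first.
  rewrite disjoint_subset => /subsetPn[e eJ]; rewrite inE negbK => eFb.
  by rewrite (bigD1 e) //= eJ /f eFb andbF mul0r.
rewrite big_mkcond; apply: eq_bigr => e _; rewrite /f /g.
case: (boolP (e \in J)) => [eJ|_] //.
by rewrite J2 // (disjointFr dis eJ).
Qed.

Lemma gnp_mass_ge0 p H : 0 <= p <= 1 -> 0 <= gnp_mass p H.
Proof.
move=> /andP[p0 p1]; apply: prodr_ge0 => e _; case: ifP => _ //.
by rewrite subr_ge0.
Qed.

Lemma gnp_mass_sum p : \sum_(H : sgraph 'I_n) gnp_mass p H = 1.
Proof.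
have := @gnp_avoid p set0; rewrite cards0 expr0 => <- => [|e]; last by rewrite inE.
by apply: eq_bigl => H; rewrite disjoint_sym disjoints_subset sub0set.
Qed.

Lemma gnp_probC p (A : pred (sgraph 'I_n)) :
  gnp_prob p A = 1 - gnp_prob p (predC A).
Proof. by rewrite /gnp_prob -(gnp_mass_sum p) [X in _ = X - _](bigID A) /= addrK. Qed.

(** * Edges between disjoint sets *)

Definition cross (A B : {set 'I_n}) : {set {set 'I_n}} :=
  [set [set x.1; x.2] | x in setX A B].

Lemma cross_card2 A B (e : {set 'I_n}) :
  [disjoint A & B] -> e \in cross A B -> #|e| = 2%N.
Proof.
move=> dis /imsetP[[a b]]; rewrite inE /= => /andP[aA bB] ->.
by rewrite cards2; case: eqP => // ab; rewrite ab (disjointFl dis bB) in aA.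
Qed.

Lemma card_cross A B : [disjoint A & B] -> #|cross A B| = (#|A| * #|B|)%N.
Proof.
move=> dis; rewrite -cardsX; apply: card_in_imset => [[a b] [a' b']].
rewrite !inE /= => /andP[aA bB] /andP[a'A b'B] eq2.
have : a \in [set a'; b'] by rewrite -eq2 !inE eqxx.
have : b \in [set a'; b'] by rewrite -eq2 !inE eqxx orbT.
rewrite !inE => /orP[/eqP eb|/eqP ->].
  by rewrite eb (disjointFr dis a'A) in bB.
by case/orP=> /eqP ea; [rewrite ea | rewrite ea (disjointFl dis b'B) in aA].
Qed.

Definition joinedb m H := [forall A : {set 'I_n}, forall B : {set 'I_n},
  [&& #|A| == m, #|B| == m & [disjoint A & B]] ==>
  ~~ [disjoint edges H & cross A B]].

Lemma joinedbP m H : joinedb m H -> joined (adj H) m.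
Proof.
move=> /forallP jm A B cA cB dis.
move: (jm A) => /forallP/(_ B); rewrite cA cB dis !eqxx /=.
rewrite disjoint_subset => /subsetPn[e eH]; rewrite inE negbK.
case/imsetP=> [[a b]]; rewrite inE /= => /andP[aA bB] eE.
by exists a, b; split=> //; rewrite /adj -eE.
Qed.

(** Union bound over at most [2 ^ n * 2 ^ n] pairs of sets, each with [m * m] crossing edges to
    avoid. *)
Lemma gnp_not_joined p m : 0 <= p <= 1 ->
  gnp_prob p (fun H => ~~ joinedb m H) <= 4 ^+ n * (1 - p) ^+ (m * m).
Proof.
move=> p01; pose bad (AB : {set 'I_n} * {set 'I_n}) :=
  [&& #|AB.1| == m, #|AB.2| == m & [disjoint AB.1 & AB.2]].
apply: (@le_trans _ _ (\sum_(AB | bad AB)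
    gnp_prob p (fun H => [disjoint edges H & cross AB.1 AB.2]))).
  rewrite /gnp_prob (exchange_big_dep predT) //= [leLHS]big_mkcond.
  apply: ler_sum => H _; case: ifP => [/forallPn[A /forallPn[B]]|_]; last first.
    by apply: sumr_ge0 => AB _; apply: gnp_mass_ge0.
  rewrite negb_imply negbK => /andP[badAB dis].
  rewrite (bigD1 (A, B)) /=; last by rewrite /bad /= badAB.
  by rewrite lerDl; apply: sumr_ge0 => AB _; apply: gnp_mass_ge0.
rewrite (eq_bigr (fun=> (1 - p) ^+ (m * m))) => [|[A B] /and3P[/eqP cA /eqP cB dis]].
  rewrite sumr_const -[leLHS]mulr_natl; apply: ler_wpM2r.
    by apply: exprn_ge0; lra.
  rewrite -natrX ler_nat; apply: leq_trans (max_card _) _.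
  have card_sets : #|{set 'I_n}| = (2 ^ n)%N.
    by rewrite -cardsT -powersetT card_powerset cardsT card_ord.
  by rewrite card_prod card_sets -expnMn.
rewrite gnp_avoid /= ?card_cross ?cA ?cB // => e; exact: cross_card2.
Qed.

(** * Invariance under relabelling *)

Lemma perm_graph_subproof pi H :
  [forall e in [set pi @: e | e : {set 'I_n} in edges H], #|e| == 2%N].
Proof.
apply/forall_inP=> _ /imsetP[e eH ->]; rewrite card_imset; last exact: perm_inj.
exact: (forall_inP (edges_card2 H)).
Qed.

Definition perm_graph pi H := SGraph (perm_graph_subproof pi H).

Lemma imset_perm_inj pi : injective (fun e : {set 'I_n} => pi @: e).
Proof. by apply: imset_inj; apply: perm_inj. Qed.

Lemma perm_graph_inj pi : injective (perm_graph pi).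
Proof.
move=> H1 H2 /(congr1 (@edges 'I_n)) /= /imset_inj eqH.
by apply: val_inj; apply: eqH; apply: imset_perm_inj.
Qed.

Lemma adj_perm_graph pi H x y : adj (perm_graph pi H) (pi x) (pi y) = adj H x y.
Proof.
rewrite /adj /= -[RHS](mem_imset _ _ (@imset_perm_inj pi)).
by rewrite imsetU1 imset_set1.
Qed.

Lemma gnp_mass_perm p pi H : gnp_mass p (perm_graph pi H) = gnp_mass p H.
Proof.
rewrite /gnp_mass (reindex_inj (@imset_perm_inj pi)) /=.
apply: eq_big => [e|e _]; first by rewrite card_imset //; apply: perm_inj.
by rewrite (mem_imset _ _ (@imset_perm_inj pi)).
Qed.

(** As relabelling preserves the law, averaging over all permutations reduces a probability to
    counting, for each fixed [H], the permutations that produce the event. *)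
Lemma gnp_prob_perm p (A : pred (sgraph 'I_n)) :
  #|{perm 'I_n}|%:R * gnp_prob p A =
  \sum_(H : sgraph 'I_n) gnp_mass p H * #|[set pi | A (perm_graph pi H)]|%:R.
Proof.
transitivity (\sum_(pi : {perm 'I_n}) gnp_prob p A).
  by rewrite sumr_const mulr_natl.
transitivity (\sum_(pi : {perm 'I_n}) \sum_(H : sgraph 'I_n)
   gnp_mass p H * (A (perm_graph pi H))%:R).
  apply: eq_bigr => pi _; rewrite /gnp_prob (reindex_inj (@perm_graph_inj pi)) /=.
  rewrite big_mkcond; apply: eq_bigr => H _; rewrite gnp_mass_perm.
  by case: (A _); rewrite ?mulr1 ?mulr0.
rewrite exchange_big; apply: eq_bigr => H _; rewrite -mulr_sumr; congr (_ * _).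
rewrite -sum1_card natr_sum [RHS]big_mkcond; apply: eq_bigr => pi _.
by rewrite inE; case: (A _).
Qed.

End BinomialRandomGraph.

(** * Embedding the tree *)

Section Embedding.
Local Open Scope ring_scope.
Variables (R : realType) (n : nat) (V : finType) (T : sgraph V) (G : sgraph 'I_n).
(** [1 / a] is a lower bound for the relative minimum degree of [G], [m] the scale of joinedness,
    [e] the number of vertices left to absorption, and [s] the number of disjoint stars. *)
Variables (a d m e s : nat).
Hypotheses (cV : #|V| = n) (treeT : is_tree T) (degT : forall x, (deg T x <= d)%N).
Hypotheses (a_gt0 : (0 < a)%N) (degG : forall x, (n <= a * deg G x)%N).
Hypotheses (m_gt0 : (0 < m)%N) (small_m : (3 * (d * m) + 5 * m <= e)%N).
Hypotheses (small_e : (2 * e <= n)%N).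
Hypotheses (stars_fit : (s * (d + 2) ^ 2 + 2 * e <= n)%N).
Hypotheses (small_s : (2 * a * (s * (d + 2)) <= n)%N).
Hypotheses (n_gt1 : (1 < n)%N).

(** Union bound over the [n ^ 2] pairs [(u, v)] of the tail in [perm_fits_tail], with
    [theta = 1 / (2a)], [s] stars of at most [d + 2] vertices and threshold [e]. *)
Let fail_bound : R :=
  n%:R ^+ 2 * (2 ^+ e * (1 - (2 * a)%:R^-1 ^+ (d + 2) / 2) ^+ s).

(** The partial embedding [phi0] into [H] is fixed before the permutation is drawn; absorption can
    then fail only if some pair [(u, v)] has fewer than [e] usable stars. *)
Lemma perm_embed_fail (H : sgraph 'I_n) : joinedb m H ->
  (#|[set pi | ~~ contains_copy T (sunion G (perm_graph pi H))]|%:R : R)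
    <= fail_bound * #|{perm 'I_n}|%:R.
Proof.
move=> /joinedbP jm.
have [par [idx [+ kids idx_inj idx_lt idx_adj]]] := tree_par treeT degT.
rewrite cV in kids idx_lt * => par_lt; pose K := (n - e)%N.
have nK : (n - K = e)%N by rewrite /K; lia.
have [phi0 [inj0 adj0]] : exists phi : nat -> 'I_n,
    (forall i j, (i < K)%N -> (j < K)%N -> phi i = phi j -> i = j) /\
    (forall j, (0 < j < K)%N -> adj H (phi (par j)) (phi j)).
  apply: (joined_embed m_gt0 jm (d := d)); rewrite ?card_ord /K; try lia.
    by move=> j jK; apply: par_lt; lia.
  move=> i; apply: leq_trans (kids i).
  have -> : iota 1 n.-1 = iota 1 (n - e).-1 ++ iota (n - e).-1.+1 e.
    by rewrite -iotaD; congr iota; lia.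
  by rewrite count_cat leq_addr.
have hom0 i j : (i < K)%N -> (j < K)%N -> tadj par i j -> adj H (phi0 i) (phi0 j).
  move=> iK jK /orP[/andP[j0 /eqP <-]|/andP[i0 /eqP <-]].
    by apply: adj0; rewrite j0.
  by rewrite adjC; apply: adj0; rewrite i0.
have [||S [sS uS subS disS]] := @disjoint_stars par n par_lt d K s _ kids _.
- by rewrite /K; lia.
- by rewrite /K; lia.
have innerP t : t \in S -> [/\ (t < K)%N, (t < n)%N &
    forall q, q \in star par n t -> (q < K)%N].
  move/subS; rewrite mem_filter mem_iota => /andP[/allP nbK tK].
  split; [by [] | by rewrite /K in tK; lia |].
  by move=> q; rewrite inE => /orP[/eqP->|/nbK].
(* If [t] and [q] were adjacent, [q] would lie in both stars. *)
have indS : {in S &, forall t q, ~~ tadj par t q}.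
  move=> t q tS qS; have [_ tn _] := innerP t tS; have [_ qn _] := innerP q qS.
  have [->|tq] := eqVneq t q; first by rewrite (tadj_irr par_lt).
  apply: contra (disS t q tS qS tq) => adjtq; apply/hasP; exists q.
    exact: mem_head.
  by have : q \in star par n t by rewrite inE mem_nbs qn adjtq orbT.
pose nbG (v : 'I_n) := [set y | adj G v y].
pose req (u v : 'I_n) t :=
  (phi0 t, nbG v) :: [seq (phi0 q, nbG u) | q <- nbs par n t].
pose few u v := [set pi : {perm 'I_n} |
  (count (fun L => fits L pi) (map (req u v) S) < e)%N].
have failE : [set pi | ~~ contains_copy T (sunion G (perm_graph pi H))] \subset
    \bigcup_(uv : 'I_n * 'I_n) few uv.1 uv.2.
  apply/subsetP=> pi; rewrite inE; apply: contraR => /bigcupP rich.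
  have {}rich u v : (e <= count (fun L => fits L pi) (map (req u v) S))%N.
    by rewrite leqNgt; apply/negP=> lt; apply: rich; exists (u, v); rewrite ?inE.
  have adjU (x y : 'I_n) : adj (sunion G (perm_graph pi H)) x y =
      adj G x y || adj (perm_graph pi H) x y by rewrite /adj /= inE.
  have [|||||||||||phi [inj hom]] := @absorb_leaves par n par_lt 'I_n
      (adj (sunion G (perm_graph pi H))) (adj G) K S (fun i => pi (phi0 i)).
  - exact: card_ord.
  - by rewrite /K; lia.
  - exact: adjC.
  - exact: adj_irr.
  - by move=> x y xy; rewrite adjU xy.
  - by move=> i j iK jK /perm_inj; apply: inj0.
  - by move=> i j iK jK ij; rewrite adjU adj_perm_graph hom0 ?orbT.
  - exact: uS.
  - exact: subS.
  - exact: indS.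
  - move=> u v; rewrite nK; apply: leq_trans (rich u v) _; rewrite count_map.
    apply: sub_count => t /=; rewrite /fits /= all_map inE => /andP[-> /allP nbt].
    by apply/allP=> q /nbt; rewrite /= inE.
  apply/existsP; exists [ffun x => phi (idx x)]; apply/andP; split.
    apply/injectiveP=> x y; rewrite !ffunE => /inj eqxy; apply: idx_inj.
    exact: eqxy.
  apply/forallP=> x; apply/forallP=> y; apply/implyP=> xy; rewrite !ffunE.
  by apply: hom; rewrite ?idx_lt ?idx_adj.
have few_card u v : (#|few u v|%:R : R) <=
    2 ^+ e * (1 - (2 * a)%:R^-1 ^+ (d + 2) / 2) ^+ s * #|{perm 'I_n}|%:R.
  have LLfst (r : seq nat) : flatten (map (map fst) (map (req u v) r)) =
      map phi0 (flatten (map (star par n) r)).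
    elim: r => //= t r ->; rewrite map_cat -map_comp.
    by congr (_ :: _ ++ _); apply: eq_map.
  have size_star t : (size (star par n t) <= d + 2)%N.
    by have := size_nbs (kids t); rewrite /=; lia.
  have req_size t : size (req u v t) = size (star par n t).
    by rewrite /= size_map.
  rewrite -sS -(size_map (req u v)).
  (* Half of the guaranteed degree [n / a] serves as [theta * n]; the other half is the allowance
     [M] for exposed points, which suffices by [small_s]. *)
  apply: (@perm_fits_tail _ _ _ _ (n%:R / (2 * a)%:R)).
  - by rewrite invr_ge0 ler0n /= invf_le1 ?ler1n ?ltr0n; lia.
  - rewrite LLfst map_inj_in_uniq.
      apply: uniq_flatten_star => // t /innerP[_ tn _]; exact: tn.
    move=> x y /flattenP[_ /mapP[t tS ->] xt] /flattenP[_ /mapP[q qS ->] yq].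
    by apply: inj0; [case: (innerP t tS) | case: (innerP q qS)] => _ _; apply.
  - rewrite ler_pdivlMr ?ltr0n; last by lia.
    rewrite -natrM ler_nat mulnC; apply: leq_trans small_s.
    rewrite leq_mul2l -sS; apply/orP; right.
    elim: (S) => //= t r IHr; rewrite -[_.+1]/(size (req u v t ++ _)).
    rewrite size_cat req_size mulSn.
    by rewrite leq_add.
  - by move=> L /mapP[t _ ->]; rewrite req_size.
  move=> x /flattenP[_ /mapP[t _ ->]] xt.
  have [w ->] : exists w, x.2 = nbG w.
    move: xt; rewrite inE => /orP[/eqP->|/mapP[q _ ->]]; first by exists v.
    by exists u.
  rewrite card_ord mulrC -mulrDl ler_pdivrMr ?ltr0n; last by lia.
  by rewrite -natrD -natrM ler_nat; have := degG w; rewrite /deg -/(nbG w); lia.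
apply: (@le_trans _ _ (\sum_(uv : 'I_n * 'I_n) #|few uv.1 uv.2|%:R)).
  rewrite -natr_sum ler_nat; apply: leq_trans (subset_leq_card failE) _.
  apply: (big_ind2 (fun (A : {set {perm 'I_n}}) c => #|A| <= c)%N) => //.
    by rewrite cards0.
  by move=> A c B c' Ac Bc'; apply: leq_trans (leq_card_setU _ _) (leq_add _ _).
apply: le_trans (ler_sum _ (fun uv _ => few_card uv.1 uv.2)) _.
rewrite sumr_const card_prod card_ord -[leLHS]mulr_natl [(n * n)%:R]natrM -expr2.
by rewrite mulrA.
Qed.

(** A graph that is not joined is charged with all permutations, a joined one with the fraction from
    [perm_embed_fail]. *)
Lemma gnp_embed_fail (p : R) : 0 <= p <= 1 ->
  1 - (4 ^+ n * (1 - p) ^+ (m * m) + fail_bound) <=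
  gnp_prob p (fun H => contains_copy T (sunion G H)).
Proof.
move=> p01; rewrite gnp_probC lerD2l lerNl opprK.
have N0 : (0 : R) < #|{perm 'I_n}|%:R by rewrite ltr0n; apply/card_gt0P; exists 1%g.
rewrite -(ler_pM2l N0) gnp_prob_perm.
have not_joined := gnp_not_joined n m p01.
apply: le_trans (ler_wpM2l (ltW N0) (lerD not_joined (lexx fail_bound))).
have B0 : 0 <= fail_bound.
  rewrite /fail_bound !mulr_ge0 ?exprn_ge0 ?ler0n //.
  have : (2 * a)%:R^-1 ^+ (d + 2) <= 1 :> R.
    by rewrite exprn_ile1 ?invr_ge0 ?ler0n // invf_le1 ?ler1n ?ltr0n; lia.
  by lra.
have -> : #|{perm 'I_n}|%:R *
    (gnp_prob p (fun H : sgraph 'I_n => ~~ joinedb m H) + fail_bound) =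
    \sum_(H : sgraph 'I_n) gnp_mass p H *
      (#|{perm 'I_n}|%:R * ((~~ joinedb m H)%:R + fail_bound)).
  under eq_bigr do rewrite mulrCA mulrDr.
  rewrite -mulr_sumr big_split /= -mulr_suml gnp_mass_sum mul1r.
  congr (_ * (_ + _)); rewrite /gnp_prob big_mkcond; apply: eq_bigr => H _.
  by case: (joinedb m H); rewrite /= ?mulr0 ?mulr1.
apply: ler_sum => H _; apply: ler_wpM2l; first exact: gnp_mass_ge0.
have [jm|_] := boolP (joinedb m H).
  by rewrite add0r [leRHS]mulrC; apply: perm_embed_fail.
by rewrite -[leLHS]mulr1 ler_pM ?ler0n ?ler_nat ?max_card ?lerDl.
Qed.

End Embedding.

(** * Asymptotics *)

(* Imported only here: its set notions shadow those of finset used above. *)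
From mathcomp Require Import all_classical all_reals all_analysis.
Import Order.TTheory GRing.Theory Num.Theory.
Import numFieldNormedType.Exports.
Local Open Scope classical_set_scope.
Local Open Scope ring_scope.

Section Estimates.
Variable R : realType.

Lemma expr1B_le_expR (x : R) k : 0 <= x <= 1 -> (1 - x) ^+ k <= expR (- (k%:R * x)).
Proof.
move=> x01; rewrite -mulrN expRM_natl; apply: lerXn2r; rewrite ?nnegrE ?expR_ge0 //.
  by lra.
exact: expR_ge1Dx.
Qed.

(** The first factor is at most [expR (3n)] since [4 <= expR 3]. As [m >= n / (2M)], the constant 16
    makes the exponent [m ^ 2 * 16 M ^ 2 / n] at least [4n]. *)
Lemma expr4_gnp_le (n m M : nat) : (0 < n)%N -> (n <= 2 * M * m)%N ->
  (16 * M ^ 2)%:R / n%:R <= 1 :> R ->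
  4 ^+ n * (1 - (16 * M ^ 2)%:R / n%:R) ^+ (m * m) <= expR (- n%:R) :> R.
Proof.
move=> n0 nm p1.
have n0R : (0 : R) < n%:R by rewrite ltr0n.
apply: (@le_trans _ _ (expR (n%:R * 3) * expR (- (n%:R * 4)))); last first.
  by rewrite -expRD ler_expR; lra.
apply: ler_pM; rewrite ?exprn_ge0 //; first by rewrite subr_ge0.
  rewrite expRM_natl; apply: lerXn2r; rewrite ?nnegrE ?expR_ge0 //.
  by have := expR_ge1Dx (3 : R); lra.
apply: le_trans (expr1B_le_expR _ _) _; first by rewrite divr_ge0 ?ler0n.
rewrite ler_expR lerN2 mulrA ler_pdivlMr // -!natrM ler_nat.
have : (n * n <= (2 * M * m) * (2 * M * m))%N by rewrite leq_mul.
have -> : (m * m * (16 * M ^ 2) = 4 * (2 * M * m * (2 * M * m)))%N.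
  by rewrite -mulnn; ring.
by lia.
Qed.

(** With [2 <= expR 1], the first factor costs at most [n / (4QL)] in the exponent, while the second
    gains about [n / (2QL)]; the summand 1 covers the rounding in [s]. *)
Lemma stars_fail_le (n e s Q L : nat) : (0 < Q)%N -> (0 < L)%N ->
  (4 * Q * L * e <= n)%N -> (n <= L * s + L)%N ->
  2 ^+ e * (1 - Q%:R^-1 / 2) ^+ s <= expR (1 - n%:R / (4 * Q * L)%:R) :> R.
Proof.
move=> Q0 L0 en ns.
have Q1 : (1 : R) <= Q%:R by rewrite ler1n.
have Qi : 0 <= (Q%:R : R)^-1 <= 1 by rewrite invr_ge0 ler0n invf_le1 // ltr0n.
apply: (@le_trans _ _ (expR e%:R * expR (- (s%:R * (Q%:R^-1 / 2))))).
  apply: ler_pM; rewrite ?exprn_ge0 //; first by lra.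
    rewrite -[e%:R]mulr1 expRM_natl; apply: lerXn2r; rewrite ?nnegrE ?expR_ge0 //.
    by have := expR_ge1Dx (1 : R); lra.
  by apply: expr1B_le_expR; lra.
rewrite -expRD ler_expR.
have D0 : (0 : R) < (4 * Q * L)%:R by rewrite ltr0n !muln_gt0 Q0 L0.
rewrite -(ler_pM2r D0) [leRHS]mulrBl divfK ?gt_eqF // mul1r [leLHS]mulrDl.
have -> : - (s%:R * (Q%:R^-1 / 2)) * (4 * Q * L)%:R = - (2 * L * s)%:R :> R.
  rewrite !natrM; field; rewrite pnatr_eq0; lia.
rewrite lerBlDr addrAC lerBrDr -natrM -!natrD ler_nat.
have : (L <= Q * L)%N by rewrite leq_pmull.
by lia.
Qed.

(** The cubic term [x ^ 3 / 6] of the exponential series at [x = n / E] beats the factor [n ^ 2]. *)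
Lemma sqr_expR_le (n E : nat) : (0 < n)%N -> (0 < E)%N ->
  n%:R ^+ 2 * expR (1 - n%:R / E%:R) <= 6 * expR 1 * E%:R ^+ 3 / n%:R :> R.
Proof.
move=> n0 E0.
have n0R : (0 : R) < n%:R by rewrite ltr0n.
have E0R : (0 : R) < E%:R by rewrite ltr0n.
have x0 : 0 <= n%:R / E%:R :> R by rewrite divr_ge0 // ltW.
have := expR_ge1Dxn 2 x0; rewrite -[3`!]/6%N => le_exp.
have {}le_exp : (n%:R / E%:R) ^+ 3 / 6 <= expR (n%:R / E%:R) :> R.
  by apply: le_trans le_exp; rewrite lerDr.
rewrite expRD expRN mulrA ler_pdivrMr ?expR_gt0 //.
apply: le_trans (ler_wpM2l _ le_exp); last first.
  by rewrite !mulr_ge0 ?exprn_ge0 ?invr_ge0 ?expR_ge0 ?ltW.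
rewrite le_eqVlt; apply/orP; left; apply/eqP; field.
by rewrite !gt_eqF.
Qed.

End Estimates.

Lemma gnp_prob_le1 (R : realType) n (p : R) (A : pred (sgraph 'I_n)) :
  0 <= p <= 1 -> gnp_prob p A <= 1.
Proof.
move=> p01; rewrite gnp_probC lerBlDr lerDl.
by apply: sumr_ge0 => H _; apply: gnp_mass_ge0.
Qed.

Theorem theorem1p1 (R : realType) (alpha : R) (Delta : nat) :
  0 < alpha ->
  exists c : R, 0 < c /\
    forall (G : forall n : nat, sgraph 'I_n)
           (V : nat -> finType) (T : forall n : nat, sgraph (V n)),
      (\forall n \near \oo,
         forall x : 'I_n, alpha * n%:R <= (deg (G n) x)%:R) ->
      (\forall n \near \oo,
         [/\ #|V n| = n, is_tree (T n) &
             forall x : V n, (deg (T n) x <= Delta)%N]) ->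
      (fun n : nat =>
         gnp_prob (c / n%:R)
           (fun H : sgraph 'I_n => contains_copy (T n) (sunion (G n) H)))
        @ \oo --> (1 : R).
Proof.
move=> alpha0; pose d := Delta.
pose a := (Num.truncn alpha^-1).+1.
have a_alpha : alpha^-1 <= a%:R by apply: ltW; apply: truncnS_gt.
(* [Q] is [theta ^ -(d + 2)] for [theta = 1 / (2a)]. Taking [n / L] stars meets both packing
   conditions, [E] keeps [2 ^ (n / E)] below the decay these stars give, and [M] ensures
   [(3d + 5) * (n / M) <= n / E] after rounding. *)
pose Q := ((2 * a) ^ (d + 2))%N; pose L := (2 * a * (d + 2) ^ 2)%N.
pose E := (4 * Q * L)%N; pose M := (E * (3 * d + 5))%N.
pose c : R := (16 * M ^ 2)%:R; pose C : R := 12 * expR 1 * E%:R ^+ 3.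
have Q0 : (0 < Q)%N by rewrite expn_gt0.
have L0 : (0 < L)%N by rewrite muln_gt0 expn_gt0 addn2.
have E0 : (0 < E)%N by rewrite muln_gt0 muln_gt0 Q0 L0.
have M0 : (0 < M)%N by rewrite muln_gt0 E0 addn_gt0 orbT.
have c0 : 0 < c by rewrite ltr0n muln_gt0 /= expn_gt0 M0.
exists c; split=> // G V T degG treeT; apply/cvgrPdist_le => eps eps0.
near=> n.
have n1 : (1 < n)%N by near: n; exact: nbhs_infty_ge.
have n_M : (M <= n)%N by near: n; exact: nbhs_infty_ge.
have n_c : c <= n%:R by near: n; exact: nbhs_infty_ger.
have n_eps : C / eps <= n%:R by near: n; exact: nbhs_infty_ger.
have degGn : forall x : 'I_n, alpha * n%:R <= (deg (G n) x)%:R by near: n.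
have [cV tree degT] : [/\ #|V n| = n, is_tree (T n) &
    forall x : V n, (deg (T n) x <= Delta)%N] by near: n.
have n0 := ltnW n1; have n0R : 0 < n%:R :> R by rewrite ltr0n.
have p01 : 0 <= c / n%:R <= 1 by rewrite divr_ge0 ?ler0n //= ler_pdivrMr // mul1r.
rewrite ger0_norm ?subr_ge0 ?gnp_prob_le1 // lerBlDr -lerBlDl.
pose e := (n %/ E)%N; pose m := (n %/ M)%N; pose s := (n %/ L)%N.
have eE : (E * e <= n)%N by rewrite mulnC leq_divM.
have sL : (L * s <= n)%N by rewrite mulnC leq_divM.
have mM : (M * m <= n)%N by rewrite mulnC leq_divM.
have sL' : (n <= L * s + L)%N.
  by have := ltnW (ltn_ceil n L0); rewrite mulSn addnC mulnC.
have m0 : (0 < m)%N by rewrite divn_gt0.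
have mM' : (n <= 2 * M * m)%N.
  apply: leq_trans (ltnW (ltn_ceil n M0)) _.
  by rewrite mulSn [(_ %/ _ * _)%N]mulnC -mulnA mul2n -addnn leq_add2r leq_pmulr.
have degG' (x : 'I_n) : (n <= a * deg (G n) x)%N.
  rewrite -(ler_nat R) natrM -[leLHS](mulKf (lt0r_neq0 alpha0)).
  by apply: ler_pM => //; rewrite ?invr_ge0 ?mulr_ge0 // ltW.
have small_m : (3 * (d * m) + 5 * m <= e)%N.
  rewrite leq_divRL //; apply: leq_trans mM.
  by rewrite (_ : (_ * E = M * m)%N) // /M; ring.
have E4 : (4 <= E)%N by rewrite /E -mulnA leq_pmulr // muln_gt0 Q0 L0.
have small_e : (4 * e <= n)%N by apply: leq_trans eE; rewrite leq_mul2r E4 orbT.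
have stars_fit : (s * (d + 2) ^ 2 + 2 * e <= n)%N.
  have le_L : (2 * (d + 2) ^ 2 * s <= L * s)%N.
    by rewrite leq_mul2r /L leq_mul2r leq_pmulr ?orbT.
  rewrite -(leq_pmul2l (ltn0Sn 1)) [leqRHS]mul2n -addnn.
  rewrite (_ : (2 * (s * (d + 2) ^ 2 + 2 * e)) = 2 * (d + 2) ^ 2 * s + 4 * e)%N; last by ring.
  exact: leq_add (leq_trans le_L sL) small_e.
have small_s : (2 * a * (s * (d + 2)) <= n)%N.
  apply: leq_trans sL; rewrite [(s * _)%N]mulnC mulnA leq_mul2r leq_mul2l.
  by rewrite -mulnn leq_pmulr ?addn2 ?orbT.
have e2 : (2 * e <= n)%N by apply: leq_trans small_e; rewrite leq_mul2r orbT.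
apply: le_trans (@gnp_embed_fail R n (V n) (T n) (G n) a d m e s cV tree degT
  (ltn0Sn _) degG' m0 small_m e2 stars_fit small_s n1 _ p01).
have fail4 := expr4_gnp_le n0 mM' (proj2 (andP p01)).
have failS : 2 ^+ e * (1 - (2 * a)%:R^-1 ^+ (d + 2) / 2) ^+ s <=
    expR (1 - n%:R / E%:R) :> R.
  by rewrite exprVn -(natrX R (2 * a)); apply: stars_fail_le.
have tail := @sqr_expR_le R n E n0 E0.
have n2 : 1 <= n%:R ^+ 2 :> R by rewrite exprn_ege1 // ler1n.
(* Both failure terms are thus at most [n ^ 2 * expR (1 - n / E)], which makes the 12 in [C] twice
   the 6 of [sqr_expR_le]. *)
have expn : expR (- n%:R) <= n%:R ^+ 2 * expR (1 - n%:R / E%:R) :> R.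
  rewrite -[leLHS]mul1r ler_pM ?expR_ge0 // ler_expR.
  have : n%:R / E%:R <= n%:R :> R.
    by rewrite ler_pdivrMr ?ltr0n // ler_peMr ?ler0n // ler1n.
  by lra.
have failS2 := ler_wpM2l (le_trans ler01 n2) failS.
have Ceps : C / n%:R <= eps by rewrite ler_pdivrMr // mulrC -ler_pdivrMr.
have CE : C / n%:R = 2 * (6 * expR 1 * E%:R ^+ 3 / n%:R) by rewrite /C; field; lra.
by rewrite -/c in fail4; rewrite lerD2l lerN2; lra.
Unshelve. all: by end_near.
Qed.
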